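(* Let $H$ be a separable complex Hilbert space. Let $B$ be an unbounded closed linear operator in $H$ and let $A$ be a bounded linear operator on $H$ such that $AB$, $A$ and $B$ are all normal. Then \[A^*AB\subset BA^*A \ \text{ and }\ AB^*B\subset B^*BA \ \Longrightarrow\ BA \text{ is normal}.\]
   Context: An unbounded operator $T$ in $H$ is a linear operator defined on a linear subspace $D(T)\subset H$ (its domain); bounded operators are defined on all of $H$. Products have their natural domains: $D(ST)=\{x\in D(T): Tx\in D(S)\}$; in particular $D(AB)=D(B)$ and $D(BA)=\{x\in H: Ax\in D(B)\}$. For operators $S,T$, the inclusion $S\subset T$ means that $D(S)\subset D(T)$ and $Sx=Tx$ for all $x\in D(S)$. An operator is closed if its graph is closed in $H\times H$. $T^*$ denotes the Hilbert space adjoint of a densely defined operator $T$. A densely defined operator $T$ is normal if it is closed and $TT^*=T^*T$ (equality of operators including domains). *)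

(* Defs.v *)
From HB Require Import structures.
From mathcomp Require Import all_boot all_order all_algebra.
From mathcomp Require Import sesquilinear.
From mathcomp Require Import all_classical all_reals all_analysis.
From mathcomp.real_closed Require Import complex.

Set Implicit Arguments.
Unset Strict Implicit.
Unset Printing Implicit Defensive.

Import Order.TTheory GRing.Theory Num.Theory.
Import numFieldNormedType.Exports.

Local Open Scope classical_set_scope.
Local Open Scope ring_scope.
Local Open Scope complex_scope.

HB.mixin Record NormedModule_isHilbert (R : realType) H
    of CompleteNormedModule R[i] H := {
  inner : {dot H for (@Num.conj R[i])};
  sqr_norm_inner : forall x : H, `|x| ^+ 2 = inner x x
}.

#[short(type="hilbertType")]
HB.structure Definition Hilbert (R : realType) :=
  {H of NormedModule_isHilbert R H & CompleteNormedModule R[i] H}.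

(* The inner product is linear in its first argument and conjugate-linear in
   the second. *)
Notation "''[' u , v ]" := (inner u v) : ring_scope.

Definition separable_space (T : topologicalType) : Prop :=
  exists2 D : set T, countable D & dense D.

(* Possibly unbounded operators.  The values of [app] outside of [dom] carry no
   meaning; operators are only compared through [op_sub] and [op_eq]. *)
Record operator (R : realType) (H : hilbertType R) := Operator {
  dom : set H;
  app :> H -> H;
  dom0 : dom 0;
  domP : forall (a : R[i]) x y, dom x -> dom y -> dom (a *: x + y);
  appP : forall (a : R[i]) x y, dom x -> dom y ->
    app (a *: x + y) = a *: app x + app y
}.

Section Operators.
Context {R : realType} {H : hilbertType R}.
Implicit Types S T : operator H.

Definition op_sub S T : Prop :=
  dom S `<=` dom T /\ forall x, dom S x -> S x = T x.

Definition op_eq S T : Prop := op_sub S T /\ op_sub T S.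

Program Definition op_comp S T : operator H :=
  @Operator R H [set x | dom T x /\ dom S (T x)] (fun x => S (T x)) _ _ _.
Next Obligation.
move=> S T; split; first exact: dom0.
have := appP (-1) (dom0 T) (dom0 T).
by rewrite scaler0 addr0 scaleN1r addNr => ->; exact: dom0.
Qed.
Next Obligation.
move=> S T a x y [Tx STx] [Ty STy]; split; first exact: domP.
by rewrite appP//; exact: domP.
Qed.
Next Obligation.
by move=> S T a x y [Tx STx] [Ty STy] /=; rewrite !appP.
Qed.

Definition densely_defined T : Prop := dense (dom T).

Definition closed_op T : Prop :=
  closed [set p : H * H | dom T p.1 /\ p.2 = T p.1].

Definition bounded_op T : Prop :=
  dom T = setT /\ exists M : R, forall x, `|T x| <= M%:C * `|x|.

Definition adjoint_at T (y z : H) : Prop :=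
  forall x, dom T x -> '[T x, y] = '[x, z].

Lemma adjoint_at_uniq T y z z' :
  densely_defined T -> adjoint_at T y z -> adjoint_at T y z' -> z = z'.
Proof.
move=> dT yz yz'; apply/eqP; rewrite -subr_eq0; apply/negPn/negP => w0.
set w := z - z' in w0.
have xw x : dom T x -> '[x, w] = 0.
  by move=> Tx; rewrite /w linearBr /= -(yz _ Tx) -(yz' _ Tx) subrr.
have [|x [wx Tx]] := dT _ _ (@ball_open _ H w `|w|).
  by exists w; apply: ballxx; rewrite normr_gt0.
move: wx; rewrite -ball_normE /= -(@ltr_pXn2r _ 2)// ?nnegrE// !sqr_norm_inner.
have wx0 : '[w, x] = 0.
  by apply/eqP; rewrite herm_eq0C; apply/eqP; exact: xw.
by rewrite (hnormBd wx0) /= gtrDl -sqr_norm_inner le_gtF ?exprn_ge0.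
Qed.

Lemma adjoint_at_lin T (a : R[i]) y y' z z' :
  adjoint_at T y z -> adjoint_at T y' z' ->
  adjoint_at T (a *: y + y') (a *: z + z').
Proof.
by move=> yz yz' x Tx; rewrite !linearDr !linearZr/= (yz _ Tx) (yz' _ Tx).
Qed.

(* The adjoint is only meaningful for a densely defined operator, where its
   domain is the set of [y] such that [adjoint_at T y z] for some, necessarily
   unique, [z]; for other [T] it is, by convention, the zero map on [H]. *)
Program Definition adjoint T : operator H :=
  @Operator R H [set y | densely_defined T -> exists z, adjoint_at T y z]
    (fun y => xget 0 [set z | densely_defined T /\ adjoint_at T y z]) _ _ _.
Next Obligation.
by move=> T dT; exists 0 => x _; rewrite !linear0r.
Qed.
Next Obligation.
move=> T a y y' Ty Ty' dT; have [z yz] := Ty dT; have [z' yz'] := Ty' dT.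
exists (a *: z + z'); exact: adjoint_at_lin.
Qed.
Next Obligation.
move=> T a y y' /= Ty Ty'.
have [dT|dT] := pselect (densely_defined T); last first.
  by do 3 (rewrite xgetPN; last by move=> z []); rewrite scaler0 addr0.
have getE u v : adjoint_at T u v ->
    xget 0 [set z | densely_defined T /\ adjoint_at T u z] = v.
  move=> uv; apply: xget_unique => //= w [_ uw].
  exact: adjoint_at_uniq uw uv.
have [z yz] := Ty dT; have [z' yz'] := Ty' dT.
by rewrite (getE _ _ yz) (getE _ _ yz'); exact/getE/adjoint_at_lin.
Qed.

Definition normal_op T : Prop :=
  [/\ densely_defined T, closed_op T &
      op_eq (op_comp T (adjoint T)) (op_comp (adjoint T) T)].

End Operators.

(* Main.v *)
Require Import Defs.
From mathcomp Require Import all_boot all_order all_algebra.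
From mathcomp Require Import sesquilinear.
From mathcomp Require Import all_classical all_reals all_analysis.
From mathcomp.real_closed Require Import complex.
From mathcomp Require Import ring lra.

(* On D(B^* B) the two commutation relations give |BAy| = |ABy|.  Since
   1 + B^* B is onto and A commutes with B^* B, the subspace D(B^* B) is a core
   (for the graph inner product) both of B and of BA; the closedness of BA and
   of AB then propagates the equality: D(BA) = D(B) and |BAx| = |ABx| there.
   The normality of A and B gives similarly |A^* B^* x| = |ABx| on D(B), so
   A^* B^* is closed; as its adjoint is contained in BA, biduality yields
   (BA)^* = A^* B^*.  Hence BA and (BA)^* have the same domain and the same
   norms, which for a closed operator is normality. *)

Set Implicit Arguments.
Unset Strict Implicit.
Unset Printing Implicit Defensive.

Import Order.TTheory GRing.Theory Num.Theory.
Import numFieldNormedType.Exports.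

Local Open Scope classical_set_scope.
Local Open Scope ring_scope.
Local Open Scope complex_scope.

(** * Real inner product and squared norm *)

Section RealInner.
Context {R : realType} {H : hilbertType R}.
Implicit Types (x y z h : H) (T : operator H) (u v : nat -> H).

(** Symmetric and with values in the ordered field [R], so that estimates become real arithmetic.
    Adjoints can still be tested with it, by [adjoint_atP]. *)
Definition rinner x y : R := complex.Re '[x, y].

Definition sqn x : R := rinner x x.

Lemma rinnerC x y : rinner x y = rinner y x.
Proof. by rewrite /rinner hermC /= mul1r; case: ('[y, x]). Qed.

Lemma rinnerDl x y z : rinner (x + y) z = rinner x z + rinner y z.
Proof. by rewrite /rinner linearDl /= raddfD. Qed.

Lemma rinnerDr x y z : rinner x (y + z) = rinner x y + rinner x z.
Proof. by rewrite !(rinnerC x) rinnerDl. Qed.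

Lemma rinnerZl (t : R) x y : rinner (t%:C *: x) y = t * rinner x y.
Proof.
rewrite /rinner linearZl_LR /=.
by case: ('[x, y]) => a b /=; rewrite mul0r subr0.
Qed.

Lemma rinnerZr (t : R) x y : rinner x (t%:C *: y) = t * rinner x y.
Proof. by rewrite !(rinnerC x) rinnerZl. Qed.

Lemma rinnerNl x y : rinner (- x) y = - rinner x y.
Proof. by rewrite -scaleN1r -(rmorphN1 (real_complex R)) rinnerZl mulN1r. Qed.

Lemma rinnerNr x y : rinner x (- y) = - rinner x y.
Proof. by rewrite !(rinnerC x) rinnerNl. Qed.

Definition rinnerE :=
  (rinnerDl, rinnerDr, rinnerNl, rinnerNr, rinnerZl, rinnerZr).

Lemma sqr_norm x : `|x| ^+ 2 = (sqn x)%:C.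
Proof.
rewrite /sqn /rinner -sqr_norm_inner.
have : `|x| ^+ 2 \is Num.real by rewrite rpredX // normr_real.
by move=> /complex_realP [k ->].
Qed.

Lemma sqn_ge0 x : 0 <= sqn x.
Proof. by rewrite -lecR -sqr_norm exprn_ge0. Qed.

Lemma sqn_eq0 x : sqn x = 0 -> x = 0.
Proof.
move=> x0; apply/eqP; rewrite -normr_eq0 -sqrf_eq0.
by rewrite sqr_norm x0.
Qed.

Lemma sqnN x : sqn (- x) = sqn x.
Proof. by rewrite /sqn !rinnerE opprK. Qed.

Lemma sqnZ (t : R) x : sqn (t%:C *: x) = t ^+ 2 * sqn x.
Proof. rewrite /sqn !rinnerE; ring. Qed.

Lemma sqnD x y : sqn (x + y) = sqn x + 2 * rinner x y + sqn y.
Proof. rewrite /sqn !rinnerE (rinnerC y x); ring. Qed.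

Lemma sqnB x y : sqn (x - y) = sqn x - 2 * rinner x y + sqn y.
Proof. rewrite sqnD sqnN rinnerNr; ring. Qed.

Lemma sqnBC x y : sqn (x - y) = sqn (y - x).
Proof. by rewrite -sqnN opprB. Qed.

Lemma sqnD_le x y : sqn (x + y) <= 2 * sqn x + 2 * sqn y.
Proof. have := sqn_ge0 (x - y); rewrite sqnB sqnD; lra. Qed.

Lemma norm_lt_sqn x (e : R) : 0 < e -> (`|x| < e%:C) = (sqn x < e ^+ 2).
Proof.
move=> e0; rewrite -(@ltr_pXn2r _ 2)// ?nnegrE ?normr_ge0 ?lecR ?(ltW e0)//.
by rewrite sqr_norm -rmorphXn ltcR.
Qed.

(** The domain is a complex subspace: testing the real identity at ['i *: x] recovers the imaginary
    parts. *)
Lemma adjoint_atP T y z :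
  adjoint_at T y z <-> forall x, dom T x -> rinner (T x) y = rinner x z.
Proof.
split=> [a x Tx|a x Tx]; first by rewrite /rinner a.
have Tix : dom T ('i *: x).
  by rewrite -[_ *: x]addr0; apply: domP => //; exact: dom0.
have T0 : T 0 = 0.
  have := Defs.appP (-1) (dom0 T) (dom0 T).
  by rewrite scaler0 addr0 scaleN1r addNr.
have Ti : T ('i *: x) = 'i *: T x.
  by have := Defs.appP 'i Tx (dom0 T); rewrite !addr0 T0 addr0.
have := a _ Tix; rewrite Ti; have := a _ Tx.
rewrite /rinner !linearZl_LR /=.
case: ('[T x, y]) => p q; case: ('[x, z]) => p' q' /= -> .
by rewrite !mul0r !sub0r !mul1r => /oppr_inj ->.
Qed.

End RealInner.

(** * Convergence of sequences and closed operators *)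

Section Sequences.
Context {R : realType} {H : hilbertType R}.
Implicit Types (x y z h : H) (T : operator H) (u v : nat -> H).

Definition seq_cvg u x := forall e : R, 0 < e ->
  exists N, forall n, (N <= n)%N -> sqn (u n - x) < e.

Definition seq_cauchy u := forall e : R, 0 < e ->
  exists N, forall n m, (N <= n)%N -> (N <= m)%N -> sqn (u n - u m) < e.

Lemma seq_cvg_cauchy u x : seq_cvg u x -> seq_cauchy u.
Proof.
move=> ux e e0; have [|N uN] := ux (e / 4); first lra.
exists N => n m Nn Nm; have := sqnD_le (u n - x) (x - u m).
rewrite addrA subrK (sqnBC x); have := uN _ Nn; have := uN _ Nm; lra.
Qed.

Lemma seq_cauchy_cvg u : seq_cauchy u -> exists x, seq_cvg u x.
Proof.
move=> uC.
have /cauchy_cvg uc : cauchy (u @ \oo).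
  apply/cauchy_exP => e e0.
  have er : e = (complex.Re e)%:C by have /complex_realP [k ->] := gtr0_real e0.
  have {}e0 : 0 < complex.Re e by rewrite -ltcR -er.
  have [|N uN] := uC (complex.Re e ^+ 2); first exact: exprn_gt0.
  exists (u N); exists N => // n /= Nn.
  by rewrite -ball_normE /= er norm_lt_sqn //; apply: uN.
exists (lim (u @ \oo)) => e e0.
have se0 : 0 < Num.sqrt e by rewrite sqrtr_gt0.
have [|N _ uN] := (cvgrPdist_lt _ _).1 uc (Num.sqrt e)%:C.
  by rewrite ltcR.
exists N => n Nn; have := uN n Nn; rewrite /= norm_lt_sqn // sqr_sqrtr ?ltW //.
by rewrite sqnBC.
Qed.

Lemma seq_cvg_uniq u x y : seq_cvg u x -> seq_cvg u y -> x = y.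
Proof.
move=> ux uy; apply/eqP; rewrite -subr_eq0; apply/eqP/sqn_eq0/eqP.
rewrite eq_le sqn_ge0 andbT; apply/ler_addgt0Pr => e e0; rewrite add0r.
have [|N uN] := ux (e / 4); first lra.
have [|M uM] := uy (e / 4); first lra.
have := uN (maxn N M) (leq_maxl _ _); have := uM (maxn N M) (leq_maxr _ _).
have := sqnD_le (x - u (maxn N M)) (u (maxn N M) - y).
by rewrite addrA subrK (sqnBC x); lra.
Qed.

Lemma seq_cvg_le (c : R) u v x y :
  (forall n, sqn (v n - y) <= c * sqn (u n - x)) -> seq_cvg u x -> seq_cvg v y.
Proof.
move=> vu ux e e0; have c0 : 0 < `|c| + 1 by rewrite ltr_wpDl.
have [|N uN] := ux (e / (`|c| + 1)); first exact: divr_gt0.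
exists N => n /uN; rewrite ltr_pdivlMr// => h.
apply: le_lt_trans (vu n) (le_lt_trans _ h).
rewrite mulrC ler_wpM2l ?sqn_ge0//; have := ler_norm c; lra.
Qed.

Lemma rinner_small u x h (e : R) : seq_cvg u x -> 0 < e ->
  exists N, forall n, (N <= n)%N -> `|rinner (u n - x) h| < e.
Proof.
move=> ux e0; have h0 := sqn_ge0 h.
(* This weight makes [s * sqn h = e - s], while [sqn w < s * e] for large [n], so both terms of the
   bound on [2 |<w, h>|] are below [e]. *)
pose s := e / (sqn h + 1).
have s0 : 0 < s by apply: divr_gt0 => //; lra.
have sh : s * (sqn h + 1) = e by rewrite /s mulfVK // gt_eqF //; lra.
have [|N uN] := ux (s * e); first exact: mulr_gt0.
exists N => n /uN; set w := u n - x => wn.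
(* AM-GM: [2 |<w, h>| <= sqn w / s + s * sqn h] *)
have /= := sqn_ge0 (w + s%:C *: h); have /= := sqn_ge0 (w - s%:C *: h).
rewrite sqnB sqnD !rinnerZr sqnZ.
have -> : s ^+ 2 * sqn h = s * (e - s) by rewrite -sh; ring.
move=> h1 h2; have ss := mulr_gt0 s0 s0.
by rewrite ltr_norml; apply/andP; split; rewrite -(ltr_pM2l s0); nra.
Qed.

(** Expanding around the limits, the cross terms vanish by [rinner_small], [sqn (v n - y)] is small,
    and [sqn (u n - x)] is dropped by positivity. *)
Lemma sqn_le_cvg u v x y : seq_cvg u x -> seq_cvg v y ->
  (forall n, sqn (u n) <= sqn (v n)) -> sqn x <= sqn y.
Proof.
move=> ux vy uv; apply/ler_addgt0Pr => e e0.
have [|N1 n1] := rinner_small (e := e / 6) x ux; first lra.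
have [|N2 n2] := rinner_small (e := e / 6) y vy; first lra.
have [|N3 n3] := vy (e / 6); first lra.
pose n := maxn N1 (maxn N2 N3).
have := n1 n (leq_maxl _ _).
have := n2 n (leq_trans (leq_maxl _ _) (leq_maxr _ _)).
have := n3 n (leq_trans (leq_maxr _ _) (leq_maxr _ _)); have := uv n.
rewrite !ltr_norml -{1}(subrK x (u n)) (sqnD _ x).
rewrite -{1}(subrK y (v n)) (sqnD _ y).
by have := sqn_ge0 (u n - x); lra.
Qed.

Lemma closed_opP T : closed_op T <-> forall u x y, (forall n, dom T (u n)) ->
  seq_cvg u x -> seq_cvg (fun n => T (u n)) y -> dom T x /\ T x = y.
Proof.
split=> [Tc u x y uT ux Tuy|Tc [x y] clxy].
  suff /Tc [] : closure [set p | dom T p.1 /\ p.2 = T p.1] (x, y) by [].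
  move=> B /nbhs_ballP [e /= e0 sB].
  have er : e = (complex.Re e)%:C by have /complex_realP [k ->] := gtr0_real e0.
  have {}e0 : 0 < complex.Re e by rewrite -ltcR -er.
  have e20 : 0 < complex.Re e ^+ 2 by exact: exprn_gt0.
  have [N uN] := ux _ e20; have [M vM] := Tuy _ e20.
  exists (u (maxn N M), T (u (maxn N M))); split=> //=.
  apply: sB; split; rewrite -ball_normE /= er norm_lt_sqn // sqnBC.
    exact/uN/leq_maxl.
  exact/vM/leq_maxr.
(* Balls of radius the square root of [1 / (n + 1)] give the bound [1 / (n + 1)] on squared
   norms. *)
have /choice [u uP] (n : nat) :
    exists z, [/\ dom T z, sqn (z - x) < n.+1%:R^-1 &
      sqn (T z - y) < n.+1%:R^-1].
  have e0 : 0 < Num.sqrt (n.+1%:R^-1 : R) by rewrite sqrtr_gt0 invr_gt0.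
  have [|[z w]] := clxy (ball (x, y) (Num.sqrt (n.+1%:R^-1 : R))%:C).
    by apply: nbhsx_ballx; rewrite ltcR.
  move=> [[/= Tz ->]] []; rewrite -!ball_normE /= !norm_lt_sqn //.
  by rewrite sqr_sqrtr ?invr_ge0// !(sqnBC _ z) !(sqnBC _ (T z)); exists z.
have cvg_inv (v : nat -> H) z :
    (forall n, sqn (v n - z) < n.+1%:R^-1) -> seq_cvg v z.
  move=> vz e e0; have [N _ NP] := near_infty_natSinv_lt (PosNum e0).
  by exists N => n Nn; apply: lt_trans (vz n) (NP n Nn).
suff [Tx <-] : dom T x /\ T x = y by [].
apply: (Tc u) => [n||].
- by have [] := uP n.
- by apply: cvg_inv => n; have [] := uP n.
- by apply: cvg_inv => n; have [] := uP n.
Qed.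

End Sequences.

(** * Orthogonal projection by minimizing sequences *)

Section Projection.
Context {R : realType} {H : hilbertType R}.
Implicit Types (a b x y z h : H) (u v : nat -> H).

(** The parallelogram law for [a - x] and [a - y]. *)
Lemma sqn_midpoint a x y :
  sqn (x - y) =
  2 * sqn (a - x) + 2 * sqn (a - y)
  - 4 * sqn (a - ((2^-1)%:C *: x + (2^-1)%:C *: y)).
Proof.
rewrite /sqn !rinnerE !(rinnerC x a) !(rinnerC y a) (rinnerC y x); lra.
Qed.

Lemma sqn_shift (t : R) a x h :
  sqn (a - (t%:C *: h + x)) =
  sqn (a - x) - 2 * t * rinner (a - x) h + t ^+ 2 * sqn h.
Proof.
rewrite /sqn !rinnerE !(rinnerC h) !(rinnerC x a); ring.
Qed.

(* The projection of [(a, b)] on the closure of the graph-like subspace [G] of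
   [H * H], as the limit of a minimizing sequence in [G]. *)
Lemma projection (G : H -> H -> Prop) a b :
  G 0 0 ->
  (forall (t : R) x y x' y', G x y -> G x' y' ->
    G (t%:C *: x + x') (t%:C *: y + y')) ->
  exists u v x y, [/\ forall n, G (u n) (v n), seq_cvg u x, seq_cvg v y &
    forall x' y', G x' y' -> rinner (a - x) x' + rinner (b - y) y' = 0].
Proof.
move=> G0 GP; pose q x y := sqn (a - x) + sqn (b - y).
(* Only combinations [t x + x'] are given, so the second pair is first halved by adding [(0, 0)]. *)
have Gmid x y x' y' : G x y -> G x' y' ->
    G ((2^-1)%:C *: x + (2^-1)%:C *: x') ((2^-1)%:C *: y + (2^-1)%:C *: y').
  move=> Gx Gx'; apply: (GP) => //.
  by have := GP 2^-1 _ _ _ _ Gx' G0; rewrite !addr0.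
pose S := [set t | exists x y, G x y /\ t = q x y].
have S_inf : has_inf S.
  split; first by exists (q 0 0), 0, 0.
  by exists 0 => _ [x [y [_ ->]]]; rewrite addr_ge0 ?sqn_ge0.
pose d := inf S.
have d_le x y : G x y -> d <= q x y.
  by move=> Gxy; apply: ge_inf; [exact: S_inf.2 | exists x, y].
have [s [s_gt0 s_small]] : exists s : nat -> R, (forall n, 0 < s n) /\
    forall e, 0 < e -> exists N, forall n, (N <= n)%N -> s n < e.
  exists (fun n => n.+1%:R^-1); split=> [n|e e0]; first by rewrite invr_gt0.
  by have [N _ NP] := near_infty_natSinv_lt (PosNum e0); exists N.
have /choice [w wP] (n : nat) :
    exists g : H * H, G g.1 g.2 /\ q g.1 g.2 < d + s n.
  have [_ [x [y [Gxy ->]]] dq] := inf_adherent (s_gt0 n) S_inf.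
  by exists (x, y).
pose u n := (w n).1; pose v n := (w n).2.
have Guv n : G (u n) (v n) by have [] := wP n.
have q_lt n : q (u n) (v n) < d + s n by have [] := wP n.
(* The midpoint is at squared distance at least [d], so the left side is less than [2 (s n + s m)],
   whence [e / 4]. *)
have uvC (e : R) : 0 < e -> exists N, forall n m, (N <= n)%N -> (N <= m)%N ->
    sqn (u n - u m) + sqn (v n - v m) < e.
  move=> e0; have [|N NP] := s_small (e / 4); first lra.
  exists N => n m /NP en /NP em.
  have := d_le _ _ (Gmid _ _ _ _ (Guv n) (Guv m)).
  rewrite (sqn_midpoint a (u n)) (sqn_midpoint b (v n)).
  by have := q_lt n; have := q_lt m; rewrite /q; lra.
have [e e0|x ux] := @seq_cauchy_cvg _ _ u.
  have [N NP] := uvC _ e0; exists N => n m Nn Nm.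
  by have := NP _ _ Nn Nm; have := sqn_ge0 (v n - v m); lra.
have [e e0|y vy] := @seq_cauchy_cvg _ _ v.
  have [N NP] := uvC _ e0; exists N => n m Nn Nm.
  by have := NP _ _ Nn Nm; have := sqn_ge0 (u n - u m); lra.
exists u, v, x, y; split=> // x' y' Gh.
set c := rinner _ _ + _; pose r := sqn x' + sqn y'.
have r0 : 0 <= r by rewrite addr_ge0 ?sqn_ge0.
(* Minimality against [(u n, v n) + t (x', y')] costs [t^2 r]. Replacing [(u n, v n)] by its limit
   costs another [t^2 r], by AM-GM, plus terms that tend to 0. *)
have c_le t : 2 * t * c <= 2 * t ^+ 2 * r.
  apply/ler_addgt0Pr => e e0.
  have [|N1 n1] := s_small (e / 3); first lra.
  have [|N2 n2] := ux (e / 3); first lra.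
  have [|N3 n3] := vy (e / 3); first lra.
  pose n := maxn N1 (maxn N2 N3).
  have := n1 n (leq_maxl _ _).
  have := n2 n (leq_trans (leq_maxl _ _) (leq_maxr _ _)).
  have := n3 n (leq_trans (leq_maxr _ _) (leq_maxr _ _)).
  have := d_le _ _ (GP t _ _ _ _ Gh (Guv n)); have := q_lt n.
  rewrite /q !sqn_shift.
  have := sqn_ge0 ((u n - x) - t%:C *: x').
  have := sqn_ge0 ((v n - y) - t%:C *: y').
  rewrite 2!(sqnB (_ - _)) !rinnerZr !sqnZ.
  rewrite /c /r !(rinnerDl, rinnerNl) !(mulrDr, mulrDl, mulrN, mulrA); lra.
have r1 : 0 < r + 1 by lra.
(* This [t] turns [c_le] into [2 (r + 1) c^2 <= r c^2], which forces [c = 0]; [r + 1] avoids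
   dividing by zero when [r = 0]. *)
have := c_le (c / (2 * (r + 1))).
have -> : 2 * (c / (2 * (r + 1))) * c =
    c ^+ 2 * (2 * (r + 1)) / (2 * (r + 1) ^+ 2).
  by field; apply: lt0r_neq0.
have -> : 2 * (c / (2 * (r + 1))) ^+ 2 * r = c ^+ 2 * r / (2 * (r + 1) ^+ 2).
  by field; apply: lt0r_neq0.
rewrite ler_pM2r ?invr_gt0 ?mulr_gt0 ?exprn_gt0// => h.
apply/eqP; rewrite -sqrf_eq0; apply/eqP; have := sqr_ge0 c; nra.
Qed.

End Projection.

(** * Adjoints, biduality and cores of closed operators *)

Section ClosedOperators.
Context {R : realType} {H : hilbertType R}.
Implicit Types (x y z w : H) (T S E : operator H) (u : nat -> H).

Lemma op0 T : T 0 = 0.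
Proof.
have := Defs.appP (-1) (dom0 T) (dom0 T).
by rewrite scaler0 addr0 scaleN1r addNr.
Qed.

Lemma domB T x y : dom T x -> dom T y -> dom T (x - y).
Proof. by move=> Tx Ty; rewrite addrC -scaleN1r; apply: domP. Qed.

Lemma opB T x y : dom T x -> dom T y -> T (x - y) = T x - T y.
Proof.
by move=> Tx Ty; rewrite addrC -scaleN1r Defs.appP // scaleN1r addrC.
Qed.

Lemma domD T x y : dom T x -> dom T y -> dom T (x + y).
Proof. by move=> Tx Ty; rewrite -(scale1r x); apply: domP. Qed.

Lemma opD T x y : dom T x -> dom T y -> T (x + y) = T x + T y.
Proof. by move=> Tx Ty; rewrite -{1}(scale1r x) Defs.appP // scale1r. Qed.

Lemma polarization T S : dom T `<=` dom S ->
  (forall x, dom T x -> sqn (S x) = sqn (T x)) ->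
  forall x y, dom T x -> dom T y -> rinner (S x) (S y) = rinner (T x) (T y).
Proof.
move=> TS eqTS x y Tx Ty; have := eqTS _ (domD Tx Ty).
by rewrite !opD ?sqnD ?eqTS //; [lra | exact: TS | exact: TS].
Qed.

Lemma adjointE T y : densely_defined T -> dom (adjoint T) y ->
  forall x, dom T x -> rinner (T x) y = rinner x (adjoint T y).
Proof.
move=> dT /(_ dT) [z yz]; apply/adjoint_atP => /=.
by have [] : [set z | densely_defined T /\ adjoint_at T y z] (adjoint T y)
  by apply: (@xgetI _ _ _ z).
Qed.

Lemma adjointI T y z : densely_defined T ->
  (forall x, dom T x -> rinner (T x) y = rinner x z) ->
  dom (adjoint T) y /\ adjoint T y = z.
Proof.
move=> dT /adjoint_atP yz; split; first by exists z.
by apply: xget_unique => // w [_ yw]; exact: adjoint_at_uniq yw yz.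
Qed.

Lemma adjoint_closed T : densely_defined T -> closed_op (adjoint T).
Proof.
move=> dT; apply/closed_opP => u x y uT ux Tuy; apply: adjointI => // h Th.
apply/eqP; rewrite -subr_eq0 -normr_eq0 eq_le normr_ge0 andbT.
apply/ler_addgt0Pr => e e0; rewrite add0r.
have [|N uN] := rinner_small (T h) (e := e / 2) ux; first lra.
have [|M vM] := rinner_small h (e := e / 2) Tuy; first lra.
pose n := maxn N M.
have := uN n (leq_maxl _ _); have := vM n (leq_maxr _ _).
rewrite !(rinnerC _ h) !(rinnerC _ (T h)) !(rinnerDr, rinnerNr).
rewrite (adjointE dT (uT n) Th) !ltr_norml => a b; rewrite ler_norml; lra.
Qed.

Lemma graph_projection T a b : closed_op T -> exists2 x, dom T x &
  forall y, dom T y -> rinner (a - x) y + rinner (b - T x) (T y) = 0.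
Proof.
move=> /closed_opP Tc; pose G x y := dom T x /\ T x = y.
have [||u [v [x [y [Guv ux vy xy]]]]] := @projection _ _ G a b.
- by split; [exact: dom0 | exact: op0].
- move=> t x y x' y' [Tx <-] [Tx' <-].
  by split; [exact: domP | exact: Defs.appP].
have Tuv : (fun n => T (u n)) = v by apply: funext => n; have [] := Guv n.
have [n|||Tx Txy] := Tc u x y; [by have [] := Guv n|by []|by rewrite Tuv|].
by exists x => // z Tz; rewrite Txy; apply: xy.
Qed.

(* Von Neumann: [1 + T^* T] is onto. *)
Lemma resolvent T w : closed_op T -> densely_defined T ->
  exists2 y, dom (op_comp (adjoint T) T) y & w = y + adjoint T (T y).
Proof.
(* Project [(w, 0)] on the graph: orthogonality of the residual [(w - y, - T y)] to the graph says
   that [T^* T y = w - y]. *)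
move=> Tc dT; have [y Ty yP] := graph_projection w 0 Tc.
have [|TTy TTyE] := @adjointI T (T y) (w - y) dT.
  move=> x Tx; have := yP _ Tx; rewrite sub0r rinnerNl.
  by rewrite (rinnerC (T x)) (rinnerC x); lra.
by exists y => //; rewrite TTyE addrCA subrr addr0.
Qed.

(** The inclusion of [T^**] in [T]. The residual of [(y, z)] after projection on the graph gives
    [T^* (z - T p) = - (y - p)]; pairing this with [(y, z)] and with [(p, T p)] and subtracting
    yields [|y - p|^2 + |z - T p|^2 = 0]. *)
Lemma biadjoint T y z : closed_op T -> densely_defined T ->
  (forall v, dom (adjoint T) v -> rinner (adjoint T v) y = rinner v z) ->
  dom T y /\ T y = z.
Proof.
move=> Tc dT yz; have [p Tp pP] := graph_projection y z Tc.
have [|Tv TvE] := @adjointI T (z - T p) (- (y - p)) dT.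
  move=> x Tx; have := pP _ Tx; rewrite rinnerNr.
  by rewrite (rinnerC (T x)) (rinnerC x); lra.
have := yz _ Tv; have := adjointE dT Tv Tp; rewrite TvE => h1 h2.
have h3 : sqn (y - p) + sqn (z - T p) = 0.
  move: h1 h2; rewrite /sqn !rinnerE.
  rewrite !(rinnerC _ y) !(rinnerC _ p) !(rinnerC _ z) !(rinnerC _ (T p)).
  by rewrite !(rinnerC p y) !(rinnerC (T p) z); lra.
have y0 : sqn (y - p) = 0.
  by have := sqn_ge0 (y - p); have := sqn_ge0 (z - T p); lra.
have z0 : sqn (z - T p) = 0 by lra.
by have /subr0_eq -> := sqn_eq0 y0; have /subr0_eq -> := sqn_eq0 z0.
Qed.

(* With [x = y + T^* T y] one has [0 = <x, y> + <T A x, T A y>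
   = |y|^2 + |T y|^2 + |T A y|^2 + |T^* T A y|^2]. *)
Lemma core_comp T (A : H -> H) : closed_op T -> densely_defined T ->
  {morph A : x y / x + y} ->
  (forall y, dom (op_comp (adjoint T) T) y ->
    dom (op_comp (adjoint T) T) (A y) /\
    A (adjoint T (T y)) = adjoint T (T (A y))) ->
  forall x, dom T (A x) ->
  (forall y, dom (op_comp (adjoint T) T) y ->
    rinner x y + rinner (T (A x)) (T (A y)) = 0) -> x = 0.
Proof.
move=> Tc dT AD AT x TAx xP; have [y yE xE] := resolvent x Tc dT.
have [[TAy TTAy] AE] := AT y yE; have [Ty TTy] := yE.
have := xP y yE; rewrite (adjointE dT TTAy TAx) xE AD AE.
rewrite !rinnerDl -(adjointE dT TTAy TAy) (rinnerC (adjoint T _) y).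
rewrite -(adjointE dT TTy Ty) => h.
have y0 : sqn y = 0.
  have := sqn_ge0 y; have := sqn_ge0 (T y); have := sqn_ge0 (T (A y)).
  by have := sqn_ge0 (adjoint T (T (A y))); rewrite /sqn in h *; lra.
by rewrite (sqn_eq0 y0) op0 op0 addr0.
Qed.

(* For closed [T] and a subspace [D] of [dom T], this says that the graph of the
   restriction of [T] to [D] is dense in the graph of [T]. *)
Definition graph_core T (D : set H) := forall x, dom T x ->
  (forall y, D y -> rinner x y + rinner (T x) (T y) = 0) -> x = 0.

(** Project [(x, T x)] on the closure of the graph over [dom E]. As [T] is closed, the residual lies
    in the graph of [T], and the core property kills it. *)
Lemma graph_core_seq T E x : closed_op T -> dom E `<=` dom T ->
  graph_core T (dom E) -> dom T x ->
  exists u, [/\ forall n, dom E (u n), seq_cvg u x &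
    seq_cvg (fun n => T (u n)) (T x)].
Proof.
move=> /closed_opP Tc ET coreE Tx; pose G x y := dom E x /\ T x = y.
have [||u [v [p [q [Guv up vq pP]]]]] := @projection _ _ G x (T x).
- by split; [exact: dom0 | exact: op0].
- move=> t y z y' z' [Ey <-] [Ey' <-]; split; first exact: domP.
  by apply: Defs.appP; exact: ET.
have Tuv : (fun n => T (u n)) = v by apply: funext => n; have [] := Guv n.
have [n|||Tp Tpq] := Tc u p q; [|by []|by rewrite Tuv|].
  by apply: ET; have [] := Guv n.
have /subr0_eq xp : x - p = 0.
  apply: coreE => [|y Ey]; first exact: domB.
  by rewrite opB // Tpq; apply: pP.
exists u; split => [n||]; first by have [] := Guv n.
  by rewrite xp.
by rewrite Tuv xp Tpq.
Qed.

(** Along a sequence approximating [x] in the graph of [T], the bound makes the values of [S]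
    Cauchy, and [S] is closed. *)
Lemma graph_core_transfer T S E (c : R) x :
  closed_op T -> closed_op S -> dom E `<=` dom T -> dom E `<=` dom S ->
  graph_core T (dom E) ->
  (forall y, dom E y -> sqn (S y) <= c * sqn (T y)) -> dom T x ->
  dom S x /\ exists u, [/\ forall n, dom E (u n),
    seq_cvg (fun n => T (u n)) (T x) & seq_cvg (fun n => S (u n)) (S x)].
Proof.
move=> Tc /closed_opP Sc ET ES coreE ST Tx.
have [u [Eu ux Tux]] := graph_core_seq Tc ET coreE Tx.
have [|y Suy] := @seq_cauchy_cvg _ _ (fun n => S (u n)).
  move=> e e0; have c0 : 0 < `|c| + 1 by rewrite ltr_wpDl.
  have [|N uN] := seq_cvg_cauchy Tux (e := e / (`|c| + 1)).
    exact: divr_gt0.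
  exists N => n m Nn Nm; have := uN _ _ Nn Nm; rewrite ltr_pdivlMr// => h.
  apply: le_lt_trans h.
  rewrite -!opB; [|exact: ET|exact: ET|exact: ES|exact: ES].
  apply: le_trans (ST _ (domB (Eu n) (Eu m))) _.
  by rewrite mulrC ler_wpM2l ?sqn_ge0//; have := ler_norm c; lra.
have [n|//|//|Sx Sxy] := Sc u x y; first exact/ES/Eu.
by split=> //; exists u; split => //; rewrite Sxy.
Qed.

Lemma sqn_le_core T S E x :
  closed_op T -> closed_op S -> dom E `<=` dom T -> dom E `<=` dom S ->
  graph_core T (dom E) ->
  (forall y, dom E y -> sqn (S y) = sqn (T y)) -> dom T x ->
  dom S x /\ sqn (S x) <= sqn (T x).
Proof.
move=> Tc Sc ET ES coreE ST Tx.
have [|Sx [u [Eu Tu Su]]] :=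
    graph_core_transfer (c := 1) Tc Sc ET ES coreE _ Tx.
  by move=> y /ST ->; rewrite mul1r.
by split=> //; apply: sqn_le_cvg Su Tu _ => n; rewrite ST.
Qed.

(** The two graph norms coincide, so Cauchy sequences and limits pass from one operator to the
    other. *)
Lemma closed_op_eq_norm T S : dom S = dom T ->
  (forall x, dom T x -> sqn (S x) = sqn (T x)) -> closed_op T -> closed_op S.
Proof.
move=> ST eqST /closed_opP Tc; apply/closed_opP => u x y.
rewrite ST => uT ux Suy.
have [|z Tuz] := @seq_cauchy_cvg _ _ (fun n => T (u n)).
  move=> e e0; have [N uN] := seq_cvg_cauchy Suy e0.
  exists N => n m Nn Nm; have := uN _ _ Nn Nm.
  by rewrite -!opB ?ST // eqST //; exact: domB.
have [//|//|//|Tx Txz] := Tc u x z; split=> //.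
apply: (@seq_cvg_uniq _ _ (fun n => S (u n))) Suy => //.
apply: (seq_cvg_le (c := 1) _ Tuz) => n.
by rewrite mul1r -Txz -!opB ?ST // eqST //; exact: domB.
Qed.

End ClosedOperators.

(** * Normality as equality of domains and norms of [T] and [T^*] *)

Section Normal.
Context {R : realType} {H : hilbertType R}.
Implicit Types (x y z w : H) (T S E : operator H) (u : nat -> H).

Lemma densely_definedW T S :
  dom T `<=` dom S -> densely_defined T -> densely_defined S.
Proof.
move=> TS dT O O0 oO; have [x [Ox Tx]] := dT O O0 oO.
by exists x; split=> //; exact: TS.
Qed.

(** The case [A = id] of [core_comp]. *)
Lemma graph_core_adjoint_comp T : closed_op T -> densely_defined T ->
  graph_core T (dom (op_comp (adjoint T) T)).
Proof.
by move=> Tc dT x Tx xP; apply: (@core_comp _ _ T id) => // x' y.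
Qed.

Lemma normal_op_adjoint T : normal_op T ->
  dom (adjoint T) = dom T /\
  forall x, dom T x -> sqn (adjoint T x) = sqn (T x).
Proof.
move=> [dT Tc [[TTs _] [sTT sTTE]]]; have sTc := adjoint_closed dT.
have eq_core y : dom (op_comp (adjoint T) T) y -> sqn (adjoint T y) = sqn (T y).
  move=> yE; have [sTy TsTy] := sTT y yE; have [Ty sTTy] := yE.
  rewrite /sqn -(adjointE dT sTy TsTy) (adjointE dT sTTy Ty).
  by have /= <- := sTTE y yE; rewrite rinnerC.
have le_sT x (Tx : dom T x) :
    dom (adjoint T) x /\ sqn (adjoint T x) <= sqn (T x).
  apply: (sqn_le_core Tc sTc _ _ _ eq_core Tx) => [y []//|y /sTT []//|].
  exact: graph_core_adjoint_comp.
have dsT : densely_defined (adjoint T).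
  by apply: densely_definedW dT => x /le_sT [].
have ssTE y :
    dom (adjoint (adjoint T)) y -> dom T y /\ T y = adjoint (adjoint T) y.
  by move=> sy; apply: biadjoint => // v; exact: adjointE.
have core_sT y : dom (op_comp (adjoint (adjoint T)) (adjoint T)) y ->
    dom (op_comp (adjoint T) T) y.
  by move=> [sTy /ssTE [TsTy _]]; apply: TTs.
have le_Ts x (sTx : dom (adjoint T) x) :
    dom T x /\ sqn (T x) <= sqn (adjoint T x).
  apply: (sqn_le_core sTc Tc _ _ (graph_core_adjoint_comp sTc dsT) _ sTx).
  - by move=> y [].
  - by move=> y /core_sT [].
  - by move=> y /core_sT /eq_core.
split; first by apply/seteqP; split=> x; [move=> /le_Ts [] | move=> /le_sT []].
move=> x Tx; have [sTx le1] := le_sT x Tx; have [_ le2] := le_Ts x sTx.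
by apply/eqP; rewrite eq_le le1.
Qed.

Lemma adjoint_normal_op T : densely_defined T -> closed_op T ->
  dom (adjoint T) = dom T ->
  (forall x, dom T x -> sqn (adjoint T x) = sqn (T x)) -> normal_op T.
Proof.
move=> dT Tc sTT eqT.
have rE x y : dom T x -> dom T y ->
    rinner (adjoint T x) (adjoint T y) = rinner (T x) (T y).
  by apply: polarization => //; rewrite sTT.
have inT x : dom (op_comp T (adjoint T)) x ->
    [/\ dom T x, dom (adjoint T) (T x) & adjoint T (T x) = T (adjoint T x)].
  move=> [sTx TsTx]; have Tx : dom T x by rewrite -sTT.
  have [|? ?] // := @adjointI _ _ T (T x) (T (adjoint T x)) dT.
  move=> y Ty; rewrite -rE // rinnerC -(adjointE dT) ?sTT // rinnerC //.
have insT x : dom (op_comp (adjoint T) T) x ->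
    [/\ dom (adjoint T) x, dom T (adjoint T x) &
      T (adjoint T x) = adjoint T (T x)].
  move=> [Tx sTTx];
  have [|? ?] := @biadjoint _ _ T (adjoint T x) (adjoint T (T x)) Tc dT.
    move=> v; rewrite sTT => Tv; rewrite rE //; exact: adjointE.
  by rewrite sTT.
by split=> //; split; split=> x; [move=> /inT []|move=> /inT []|
  move=> /insT []|move=> /insT []].
Qed.

Lemma bounded_op_sqn A : bounded_op A ->
  exists c : R, forall x, sqn (A x) <= c * sqn x.
Proof.
move=> [_ [M AM]]; exists (M ^+ 2) => x.
rewrite -lecR rmorphM rmorphXn /= -!sqr_norm -exprMn.
by rewrite ler_pXn2r // nnegrE ?normr_ge0 // (le_trans _ (AM x)).
Qed.

Lemma closed_op_comp_bounded A T :
  bounded_op A -> closed_op T -> closed_op (op_comp T A).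
Proof.
move=> bA /closed_opP Tc; apply/closed_opP => u x y uT ux TAuy.
have [c Ac] := bounded_op_sqn bA; have domA z : dom A z by rewrite bA.1.
have Aux : seq_cvg (fun n => A (u n)) (A x).
  by apply: seq_cvg_le ux => n; rewrite -opB.
have [n|//|//|TAx TAxy] := Tc (fun n => A (u n)) (A x) y; last by [].
by have [] := uT n.
Qed.

End Normal.

(** * Normality of [BA] from the two commutation relations *)

Theorem theorem3p2 (R : realType) (H : hilbertType R) (A B : operator H) :
  separable_space H ->
  closed_op B -> bounded_op A ->
  normal_op (op_comp A B) -> normal_op A -> normal_op B ->
  op_sub (op_comp (adjoint A) (op_comp A B))
         (op_comp B (op_comp (adjoint A) A)) ->
  op_sub (op_comp A (op_comp (adjoint B) B))
         (op_comp (op_comp (adjoint B) B) A) ->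
  normal_op (op_comp B A).
Proof.
move=> _ Bc bA [_ ABc _] nA nB [AABd AABe] [ABBd ABBe].
have [dA _ _] := nA; have [dB _ _] := nB.
have [sAd sAA] := normal_op_adjoint nA; have [sBd sBB] := normal_op_adjoint nB.
have domA x : dom A x by rewrite bA.1.
have domsA x : dom (adjoint A) x by rewrite sAd.
have AE x y : rinner (A x) y = rinner x (adjoint A y) by exact: adjointE.
have AAE x y : rinner (adjoint A (A x)) y = rinner x (adjoint A (A y)).
  by rewrite rinnerC -AE rinnerC AE.
have AAB x : dom B x -> dom B (adjoint A (A x)) /\
    adjoint A (A (B x)) = B (adjoint A (A x)).
  move=> Bx; have ABx : dom (op_comp (adjoint A) (op_comp A B)) x by [].
  by have [_ ?] := AABd x ABx; split=> //; exact: AABe.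
pose BB := op_comp (adjoint B) B.
have ABB y : dom BB y -> dom BB (A y) /\
    A (adjoint B (B y)) = adjoint B (B (A y)).
  move=> yE; have ABBy : dom (op_comp A BB) y by [].
  by have [_ ?] := ABBd y ABBy; split=> //; exact: ABBe.
(* [|BAy|^2 = <Ay, B^* B A y> = <Ay, A B^* B y> = <A^* A y, B^* B y> = <B A^* A y, By> = <A^* A B y,
   By> = |ABy|^2]. *)
have eqBB y : dom BB y -> sqn (B (A y)) = sqn (A (B y)).
  move=> yE; have [By sBBy] := yE; have [[BAy sBBAy] ABBy] := ABB y yE.
  have [BAAy AABy] := AAB y By.
  rewrite /sqn (adjointE dB sBBAy BAy) -ABBy rinnerC AE.
  by rewrite rinnerC -(adjointE dB sBBy BAAy) -AABy rinnerC -AE.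
have [c Ac] := bounded_op_sqn bA.
have BAc : closed_op (op_comp B A) by exact: closed_op_comp_bounded.
have BB_B : dom BB `<=` dom B by move=> y [].
have BB_BA : dom BB `<=` dom (op_comp B A) by move=> y /ABB [[]].
have BB_AB : dom BB `<=` dom (op_comp A B) by move=> y [].
(* On the core [D(B^* B)] of [B], [|BAy| = |ABy|] is controlled by [|By|] since [A] is bounded. *)
have B_BA x (Bx : dom B x) :
    dom (op_comp B A) x /\ sqn (B (A x)) <= sqn (A (B x)).
  have [|BAx [u [uBB Bu BAu]]] := graph_core_transfer (c := c) Bc BAc BB_B BB_BA
    (graph_core_adjoint_comp Bc dB) _ Bx.
    by move=> y yE /=; rewrite eqBB.
  split=> //; apply: (sqn_le_cvg (v := fun n => A (B (u n))) BAu) => [|n].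
    by apply: seq_cvg_le Bu => n; rewrite -opB.
  by rewrite /= eqBB.
(* Here [D(B^* B)] must be a core of [BA], which is [core_comp] for [A] commuting with [B^* B]; the
   limit stays in [D(AB)] because [AB] is closed. *)
have BA_B x (BAx : dom (op_comp B A) x) :
    dom (op_comp A B) x /\ sqn (A (B x)) <= sqn (B (A x)).
  apply: (sqn_le_core BAc ABc BB_BA BB_AB _ _ BAx) => [y [_ BAy] yP|y yE].
    by apply: (core_comp Bc dB _ ABB BAy yP) => y' z'; rewrite opD.
  by rewrite /= eqBB.
have BAd : dom (op_comp B A) = dom B.
  by apply/seteqP; split=> x; [move=> /BA_B [[]] | move=> /B_BA []].
have ABd : dom (op_comp A B) = dom B by apply/seteqP; split=> x // [].
have eqBA x : dom B x -> sqn (B (A x)) = sqn (A (B x)).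
  move=> Bx; have [BAx le1] := B_BA x Bx; have [_ le2] := BA_B x BAx.
  by apply/eqP; rewrite eq_le le1.
pose K := op_comp (adjoint A) (adjoint B).
have Kd : dom K = dom B.
  by apply/seteqP; split=> x; [move=> []; rewrite sBd | rewrite -sBd].
have eqK x : dom B x -> sqn (K x) = sqn (A (B x)).
  move=> Bx; have [BAAx AABx] := AAB x Bx; rewrite /K /= sAA //.
  (* Taking adjoints in the first relation gives [B^* A^* A x = A^* A B^* x]. Then
     [|A B^* x|^2 = <B^* x, B^* A^* A x>], and polarization of [|B^* x| = |Bx|] turns this into
     [<Bx, B A^* A x> = |ABx|^2]. *)
  have [|_ sBAAx] :=
    @adjointI _ _ B (adjoint A (A x)) (adjoint A (A (adjoint B x))) dB.
    move=> y By; have [BAAy AABy] := AAB y By.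
    by rewrite -AAE AABy (adjointE dB) ?sBd // AAE.
  rewrite /sqn AE -sBAAx (polarization _ sBB) ?sBd //.
  by rewrite -AABx -AE.
have Kc : closed_op K.
  by apply: closed_op_eq_norm ABc => [|x]; rewrite ?Kd ABd //; exact: eqK.
have dK : densely_defined K by rewrite /densely_defined Kd.
have dBA : densely_defined (op_comp B A) by rewrite /densely_defined BAd.
(* [K^*] is contained in [BA]: [<B^* x, A v> = <K x, v> = <x, K^* v>], and biduality for [B]
   applies. *)
have sK v : dom (adjoint K) v -> dom B (A v) /\ B (A v) = adjoint K v.
  move=> sKv; apply: biadjoint => // x sBx.
  by rewrite rinnerC AE rinnerC (adjointE dK).
have sBA y : dom B y <-> dom (adjoint (op_comp B A)) y.
  split=> [By|sy].
    have [|//] := @adjointI _ _ (op_comp B A) y (K y) dBA.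
    by move=> x [_ BAx] /=; rewrite (adjointE dB) ?sBd // AE.
  rewrite -Kd.
  (* Since [K^*] is contained in [BA], [(BA)^*] is contained in [K^**], hence in the closed operator
     [K]. *)
  have [|//] := @biadjoint _ _ K y (adjoint (op_comp B A) y) Kc dK.
  move=> v sKv; have [BAv <-] := sK v sKv.
  exact: (adjointE dBA sy (x := v)).
have sBAE y : dom B y -> adjoint (op_comp B A) y = K y.
  move=> By; have [|//] := @adjointI _ _ (op_comp B A) y (K y) dBA.
  by move=> x [_ BAx] /=; rewrite (adjointE dB) ?sBd // AE.
apply: adjoint_normal_op => //.
  by rewrite BAd; apply/seteqP; split=> y /sBA.
by move=> y; rewrite BAd => By; rewrite sBAE // eqK // -eqBA.
Qed.
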